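(* Let $F$ be a field of characteristic $2$. Let $\phi$ be an anisotropic quasilinear quadratic form over $F$ such that $2^n+2^{n-2}<\dim\phi\leq 2^{n+1}$ for some integer $n\geq 2$. If $\phi$ has maximal splitting, then $\phi$ is a quasi-Pfister neighbour.
   Context: Let $F$ be a field of characteristic $2$. A quasilinear quadratic form over $F$ is a quadratic form $\phi\colon V_\phi\to F$ on a finite-dimensional $F$-vector space with $\phi(v+w)=\phi(v)+\phi(w)$ for all $v,w$ (equivalently, in a basis, $\phi=\langle a_1,\dots,a_n\rangle:=a_1X_1^2+\dots+a_nX_n^2$ with $a_i\in F$). It is isotropic if $\phi(v)=0$ for some $v\neq0$, anisotropic otherwise. The set of $v$ with $\phi(v)=0$ is a subspace whose dimension is denoted $i_0(\phi)$. For a field extension $L/F$, $\phi_L$ denotes extension of scalars. If $\phi$ is anisotropic of dimension $>1$, $X_\phi=\{\phi=0\}\subset\mathbb P(V_\phi)$ is integral; $F(\phi)$ denotes its function field, and $i_1(\phi):=i_0(\phi_{F(\phi)})$. An anisotropic form $\phi$ with $\dim\phi=2^n+m$, $n\geq0$, $m\in[1,2^n]$, has maximal splitting if $i_1(\phi)=m$. $\psi$ is a subform of $\phi$ if there is an injective linear map $f\colon V_\psi\to V_\phi$ with $\phi\circ f=\psi$; forms are similar if they are isomorphic up to multiplication by a scalar in $F^*$. A quasi-Pfister form is $\langle 1\rangle$ or a tensor product $\langle 1,a_1\rangle\otimes\dots\otimes\langle 1,a_r\rangle$, $a_i\in F$. A form $\phi$ of dimension $>1$ is a quasi-Pfister neighbour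 if it is similar to a subform of a quasi-Pfister form $\pi$ with $2\dim\phi>\dim\pi$. *)

(* Defs.v *)
From HB Require Import structures.
From mathcomp Require Import all_boot all_order all_algebra.
From mathcomp Require Import mpoly.

Set Implicit Arguments.
Unset Strict Implicit.
Unset Printing Implicit Defensive.

Import GRing.Theory.
Local Open Scope ring_scope.

(* A quadratic form whose polar form vanishes identically. *)
Definition quasilinear_form (F : fieldType) (V : vectType F) (phi : V -> F) :=
  (forall (a : F) (v : V), phi (a *: v) = a ^+ 2 * phi v) /\
  (forall v w : V, phi (v + w) = phi v + phi w).

Definition isotropic (F : fieldType) (V : vectType F) (phi : V -> F) :=
  exists v : V, v != 0 /\ phi v = 0.

Definition anisotropic (F : fieldType) (V : vectType F) (phi : V -> F) :=
  ~ isotropic phi.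

(* i_0(phi) = k.  The subspace U is determined by its elements, so at most one
   k qualifies. *)
Definition isotropy_index (F : fieldType) (V : vectType F) (phi : V -> F)
    (k : nat) :=
  exists U : {vspace V}, (forall v, v \in U <-> phi v = 0) /\ \dim U = k.

Definition isometric (F : fieldType) (V W : vectType F)
    (phi : V -> F) (psi : W -> F) :=
  exists f : 'Hom(V, W),
    [/\ lker f = 0%VS, limg f = fullv & forall v, psi (f v) = phi v].

Definition subform (F : fieldType) (V W : vectType F)
    (psi : W -> F) (phi : V -> F) :=
  exists f : 'Hom(W, V), lker f = 0%VS /\ forall w, phi (f w) = psi w.

Definition similar (F : fieldType) (V W : vectType F)
    (phi : V -> F) (psi : W -> F) :=
  exists c : F, c != 0 /\ isometric phi (fun w => c * psi w).

(* The form <s_0, ..., s_(n-1)> on F^n. *)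
Definition diag_form (F : fieldType) (s : seq F) (v : 'rV[F]_(size s)) : F :=
  \sum_(i < size s) s`_i * v 0 i ^+ 2.

(* <s> (x) <t> = < s_i t_j >_(i, j). *)
Definition diag_tensor (F : fieldType) (s t : seq F) : seq F :=
  [seq x * y | x <- s, y <- t].

Definition pfister_coefs (F : fieldType) (s : seq F) : seq F :=
  foldr (fun a t => diag_tensor [:: 1; a] t) [:: 1] s.

Definition quasi_pfister (F : fieldType) (s : seq F) :
    'rV[F]_(size (pfister_coefs s)) -> F :=
  @diag_form F (pfister_coefs s).

Definition quasi_pfister_neighbour (F : fieldType) (V : vectType F)
    (phi : V -> F) :=
  (1 < \dim {:V})%N /\
  exists (s : seq F) (W : vectType F) (sigma : W -> F),
    [/\ similar phi sigma,
        subform sigma (@quasi_pfister F s)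
      & (size (pfister_coefs s) < 2 * \dim {:V})%N].

(* A quasilinear form has no cross terms, so it is diagonal in any basis; its
   diagonal coefficients in the basis [vbasis fullv] are used to form both its
   homogeneous polynomial and its scalar extensions. *)
Definition form_coef (F : fieldType) (V : vectType F) (phi : V -> F)
    (i : 'I_(\dim {:V})) : F :=
  phi (tnth (vbasis {:V}) i).

Definition form_poly (F : fieldType) (V : vectType F) (phi : V -> F) :
    {mpoly F[\dim {:V}]} :=
  \sum_i (form_coef phi i)%:MP * 'X_i ^+ 2.

Definition scalar_ext (F : fieldType) (V : vectType F) (phi : V -> F)
    (L : fieldType) (iota : {rmorphism F -> L}) (v : 'rV[L]_(\dim {:V})) : L :=
  \sum_i iota (form_coef phi i) * v 0 i ^+ 2.

(* L, viewed as an extension of F along iota, is the function field of the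
   projective quadric {phi = 0}.  With S the homogeneous coordinate ring of
   P(V), that function field is the degree 0 part of the localization of
   S / (phi) at its nonzero homogeneous elements.  The two conditions say that
   p / q |-> p(x) / q(x) is a well defined injection of it into L (the first),
   and that this injection is onto (the second); x is the generic point. *)
Definition is_function_field (F : fieldType) (V : vectType F) (phi : V -> F)
    (L : fieldType) (iota : {rmorphism F -> L}) :=
  exists x : 'I_(\dim {:V}) -> L,
    (forall (d : nat) (p : {mpoly F[\dim {:V}]}), p \is d.-homog ->
       (mmap iota x p = 0 <-> exists q, p = q * form_poly phi)) /\
    (forall z : L, exists (d : nat) (p q : {mpoly F[\dim {:V}]}),
       [/\ p \is d.-homog, q \is d.-homog, mmap iota x q != 0
         & z = mmap iota x p / mmap iota x q]).

(* i_1(phi) = k.  The function field is unique up to F-isomorphism, hence k does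
   not depend on the choice of L. *)
Definition first_isotropy_index (F : fieldType) (V : vectType F) (phi : V -> F)
    (k : nat) :=
  exists (L : fieldType) (iota : {rmorphism F -> L}),
    is_function_field phi iota /\ isotropy_index (scalar_ext phi iota) k.

Definition maximal_splitting (F : fieldType) (V : vectType F) (phi : V -> F) :=
  anisotropic phi /\
  exists n m : nat,
    [/\ \dim {:V} = (2 ^ n + m)%N, (1 <= m <= 2 ^ n)%N
      & first_isotropy_index phi m].

(* Main.v *)
From HB Require Import structures.
From mathcomp Require Import all_boot all_order all_algebra.
From mathcomp Require Import mpoly ring.
From Stdlib Require Import Classical.
Require Import Defs.

(* Diagonalize phi as <a_1, ..., a_d>, let x be the generic point of its quadric,
   L the function field, and E the L^2-subspace of L of values of phi_L; here
   dim E = d - i_1(phi) = 2^n.  An isotropic vector of phi_L lifts to polynomials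
   P_i with sum_i a_i P_i^2 = q phi.  Restricting this identity to the line
   x + wT, on which phi is phi_L(w) T^2, and comparing coefficients of T^2 gives
   q(x) phi_L(w) in E.  So every isotropic vector yields an element q(x) of the
   stabilizer field H of E, and independent vectors yield L^2-independent
   elements: [H : L^2] >= i_1(phi) > 2^(n-2).  After scaling, E contains 1 and H,
   and being at most quadratic over H it is itself a field.

   Let b be a basis of the field generated over F^2 by the a_i / a_1.  All its
   elements lie in E / a_1, so <b> has over L a totally isotropic subspace of
   dimension at least |b| - 2^n.  The same line argument with b in place of a
   embeds this subspace semilinearly into E, whence |b| <= 2^(n+1). *)

Set Implicit Arguments.
Unset Strict Implicit.
Unset Printing Implicit Defensive.

Import GRing.Theory.
Local Open Scope ring_scope.

(** * Linear dependence over the subfield K^2, and squaring in characteristic 2 *)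

Definition sqspan (K : fieldType) (I : finType) (c : I -> K) (y : K) :=
  exists t : I -> K, y = \sum_i c i * t i ^+ 2.

(** Scalars from K^2 are recorded by their square roots. Independence of [c] over K^2 is anisotropy
    of the diagonal form with coefficients [c]. *)
Definition sqindep (K : fieldType) (I : finType) (c : I -> K) :=
  forall t : I -> K, \sum_i c i * t i ^+ 2 = 0 -> forall i, t i = 0.

Section CharTwo.
Variables (R : comNzRingType) (charR : 2%N \in [pchar R]).

Lemma sqrrD2 (x y : R) : (x + y) ^+ 2 = x ^+ 2 + y ^+ 2.
Proof. exact: (pFrobenius_autD_comm charR (mulrC x y)). Qed.

Lemma sqrr_sum2 (I : Type) (r : seq I) (P : pred I) (f : I -> R) :
  (\sum_(i <- r | P i) f i) ^+ 2 = \sum_(i <- r | P i) f i ^+ 2.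
Proof.
by elim/big_rec2: _ => [|i x y _ <-]; rewrite ?expr0n // sqrrD2.
Qed.

End CharTwo.

Lemma sum_delta_sqr (K : fieldType) (I : finType) (c : I -> K) i :
  \sum_j c j * (j == i)%:R ^+ 2 = c i.
Proof.
rewrite (bigD1 i) //= eqxx expr1n mulr1 big1 ?addr0 // => j /negbTE ->.
by rewrite expr0n mulr0.
Qed.

Lemma sqindep_neq0 (K : fieldType) (I : finType) (c : I -> K) i :
  sqindep c -> c i != 0.
Proof.
move=> c_ind; apply/eqP => ci; have := sum_delta_sqr c i.
by rewrite ci => /c_ind/(_ i)/eqP; rewrite eqxx oner_eq0.
Qed.

Lemma exists_max_seq (T : eqType) (s : seq T) (f : T -> nat) :
  s != [::] -> exists2 x, x \in s & forall y, y \in s -> (f y <= f x)%N.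
Proof.
elim: s => // x s IH _; have [->|/IH [y y_s y_max]] := eqVneq s [::].
  by exists x; rewrite ?mem_head // => y; rewrite inE => /eqP ->.
case: (leqP (f x) (f y)) => [le|/ltnW le].
  exists y; first by rewrite inE y_s orbT.
  by move=> z; rewrite inE => /predU1P [->|/y_max].
exists x; rewrite ?mem_head // => z; rewrite inE => /predU1P [->//|/y_max].
by move/leq_trans; apply.
Qed.

(** * Divisibility by a diagonal quadratic polynomial *)

Section Polynomials.
Variables (F : fieldType) (charF : 2%N \in [pchar F]) (d : nat).
Implicit Types (p q : {mpoly F[d]}) (m : 'X_{1..d}).

Lemma pchar_mpoly2 : 2%N \in [pchar {mpoly F[d]}].
Proof. by rewrite pchar_lalg. Qed.

Lemma mpoly_sqrE p :
  p ^+ 2 = \sum_(m <- msupp p) p@_m ^+ 2 *: 'X_[m + m].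
Proof.
rewrite {1}[p]mpolyE (sqrr_sum2 pchar_mpoly2); apply: eq_bigr => m _.
by rewrite exprZn mpolyXD expr2.
Qed.

Lemma mcoeff_sqrD p m : (p ^+ 2)@_(m + m) = p@_m ^+ 2.
Proof.
rewrite mpoly_sqrE raddf_sum /=.
have dbl_inj k : ((k + k)%MM == (m + m)%MM) = (k == m).
  apply/eqP/eqP => [/mnmP E|->//]; apply/mnmP => i; have := E i.
  by rewrite !mnmDE !addnn => /double_inj.
case: (boolP (m \in msupp p)) => [m_p|m_p].
  rewrite (bigD1_seq m) ?msupp_uniq //= mcoeffZ mcoeffX eqxx mulr1.
  rewrite big1 ?addr0 // => k /negbTE k_m.
  by rewrite mcoeffZ mcoeffX dbl_inj k_m mulr0.
rewrite (memN_msupp_eq0 m_p) expr0n /= big_seq big1 // => k k_p.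
rewrite mcoeffZ mcoeffX dbl_inj; case: eqP => [E|]; last by rewrite mulr0.
by rewrite -E k_p in m_p.
Qed.

Lemma msupp_sqr p m :
  m \in msupp (p ^+ 2) -> exists2 k, k \in msupp p & m = (k + k)%MM.
Proof.
rewrite mpoly_sqrE => /msupp_sum_le /flattenP [s /mapP [k]].
rewrite filter_predT => k_p -> /msuppZ_le; rewrite msuppX inE => /eqP ->.
by exists k.
Qed.

(** Taking the coefficient at [m + m] turns the relation into one over F between the coefficients
    [(P i)@_m]. *)
Lemma sqindep_mpoly (I : finType) (b : I -> F) (P : I -> {mpoly F[d]}) :
  sqindep b -> \sum_i (b i)%:MP * P i ^+ 2 = 0 -> forall i, P i = 0.
Proof.
move=> b_ind E i; apply/mpolyP => m; rewrite mcoeff0.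
apply: (b_ind (fun i => (P i)@_m)).
have /(congr1 (mcoeff (m + m))) := E.
rewrite mcoeff0 raddf_sum /= => Em; rewrite -[RHS]Em; apply: eq_bigr => j _.
by rewrite mcoeffCM mcoeff_sqrD.
Qed.

Variables (a : 'I_d -> F) (i0 : 'I_d) (a0 : a i0 != 0).

(** For [a := form_coef phi] this unfolds to [form_poly phi]. *)
Definition diag_poly : {mpoly F[d]} := \sum_i (a i)%:MP * 'X_i ^+ 2.
Local Notation fp := diag_poly.

Lemma diag_poly_homog : fp \is 2.-homog.
Proof.
apply: rpred_sum => i _; rewrite mul_mpolyC; apply: rpredZ.
by apply: (dhomogMn (d := 1) 2); rewrite dhomogX /= mdeg1.
Qed.

Lemma diag_poly_neq0 : fp != 0.
Proof.
apply/eqP => /(congr1 (mcoeff (U_(i0) + U_(i0)))) /eqP.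
rewrite mcoeff0 raddf_sum (bigD1 i0) //= mcoeffCM mcoeff_sqrD mcoeffXU eqxx.
rewrite expr1n mulr1 big1 ?addr0 ?(negbTE a0) // => i /negbTE ne.
by rewrite mcoeffCM mcoeff_sqrD mcoeffXU ne expr0n mulr0.
Qed.

(** Division by [fp] in the variable ['X_i0]: as [a i0] is invertible, the square of this variable
    can be traded modulo [fp] for the squares of the others. *)
Lemma normal_form p : exists p' r,
  p = p' + r * fp /\ forall m, m \in msupp p' -> (m i0 <= 1)%N.
Proof.
pose red p := exists p' r,
  p = p' + r * fp /\ forall m, m \in msupp p' -> (m i0 <= 1)%N.
have red0 : red 0.
  by exists 0, 0; rewrite mul0r addr0; split=> // m; rewrite msupp0.
have redD p1 p2 : red p1 -> red p2 -> red (p1 + p2).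
  move=> [p1' [r1 [-> h1]]] [p2' [r2 [-> h2]]].
  exists (p1' + p2'), (r1 + r2); rewrite mulrDl addrACA; split=> // m.
  by move/msuppD_le; rewrite mem_cat => /orP [/h1|/h2].
have redZ c p1 : red p1 -> red (c *: p1).
  move=> [p1' [r1 [-> h1]]]; exists (c *: p1'), (c *: r1).
  by rewrite scalerDr scalerAl; split=> // m /msuppZ_le /h1.
have redM r : red (r * fp).
  by exists 0, r; rewrite add0r; split=> // m; rewrite msupp0.
have redX k m : (m i0 <= k)%N -> red 'X_[m].
  elim/ltn_ind: k m => k IH m m_k.
  case: (leqP (m i0) 1) => [m1|m2].
    exists 'X_[m], 0; rewrite mul0r addr0; split=> // m'.
    by rewrite msuppX inE => /eqP ->.
  pose u i : 'X_{1..d} := (U_(i) + U_(i))%MM.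
  pose m' := (m - u i0)%MM.
  have mE : m = (m' + u i0)%MM.
    apply/mnmP => i; rewrite mnmDE mnmBE subnK // mnmDE !mnm1E.
    by case: eqP => // <-.
  have XE i : 'X_[m' + u i] = 'X_[m'] * 'X_i ^+ 2 :> {mpoly F[d]}.
    by rewrite mpolyXD mpolyXD expr2.
  (* One factor ['X_i0 ^+ 2] is replaced using [fp]; the monomials left over have exponent at [i0]
     lower by 2. *)
  have -> : 'X_[m] = (a i0)^-1 *: ('X_[m'] * fp) -
     \sum_(i | i != i0) ((a i0)^-1 * a i) *: 'X_[m' + u i] :> {mpoly F[d]}.
    rewrite /fp (bigD1 i0) //= mulrDr scalerDr -addrA.
    rewrite mulr_sumr scaler_sumr -sumrB big1 ?addr0 => [|i _]; last first.
      by rewrite XE mul_mpolyC -scalerAr scalerA subrr.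
    by rewrite mul_mpolyC -scalerAr scalerA mulVf // scale1r -XE -mE.
  apply: (redD _ _); first exact: (redZ _ _).
  rewrite -scaleN1r; apply: (redZ _ _).
  elim/big_rec: _ => // i q ne red_q. apply: (redD _ _) => //; apply: (redZ _ _).
  have m'E : (m' i0 + 2 = m i0)%N.
    by rewrite [in RHS]mE mnmDE mnmDE mnm1E eqxx.
  have lt_k : (m' i0 < k)%N by rewrite (leq_trans _ m_k) // -m'E addn2 ltnS.
  by apply: (IH _ lt_k); rewrite mnmDE mnmDE mnm1E (negbTE ne) addn0.
elim/mpolyind: p => [|c m p _ _ IH]; first exact: red0.
by apply: (redD _ _) => //; apply: (redZ _ _); apply: (redX (m i0)).
Qed.

(* After reduction of the P i modulo fp the left side has degree at most 2 in
   'X_i0, whereas a nonzero multiple of fp ^+ 2 has degree at least 4. *)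
Lemma sqr_diag_poly_dvd (I : finType) (b : I -> F) (P : I -> {mpoly F[d]}) q :
  sqindep b -> \sum_i (b i)%:MP * P i ^+ 2 = q * fp ^+ 2 ->
  forall i, exists r, P i = r * fp.
Proof.
move=> b_ind E.
have [P' /fin_all_exists [r h]] := fin_all_exists (fun i => normal_form (P i)).
have sP i : P i = P' i + r i * fp by case: (h i).
have E' : \sum_i (b i)%:MP * P' i ^+ 2 =
          (q - \sum_i (b i)%:MP * r i ^+ 2) * fp ^+ 2.
  apply/eqP; rewrite mulrBl -E eq_sym subr_eq; apply/eqP.
  rewrite mulr_suml -big_split; apply: eq_bigr => i _ /=.
  rewrite sP (sqrrD2 pchar_mpoly2) exprMn mulrDr.
  by congr (_ + _); rewrite mulrA.
suff q0 : q - \sum_i (b i)%:MP * r i ^+ 2 = 0.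
  move: E'; rewrite q0 mul0r => /(sqindep_mpoly b_ind) P'0 i.
  by exists (r i); rewrite sP P'0 add0r.
move: (q - _) E' => {E}q E; apply/eqP; apply: contraT; rewrite -msupp_eq0.
case/(exists_max_seq (fun m : 'X_{1..d} => m i0)) => m m_q m_max.
pose u i : 'X_{1..d} := ((U_(i) + U_(i)) + (U_(i) + U_(i)))%MM.
(* Only the [i0] term of [fp ^+ 2] reaches this monomial: for any other [i], a monomial of [q] with
   exponent [m i0 + 4] at [i0] would be needed, against the maximality of [m i0]. *)
have : (m + u i0)%MM \in msupp (q * fp ^+ 2).
  rewrite mcoeff_msupp /fp (sqrr_sum2 pchar_mpoly2) mulr_sumr raddf_sum /=.
  have XE i : q * ((a i)%:MP * 'X_i ^+ 2) ^+ 2 = a i ^+ 2 *: (q * 'X_[u i]).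
    rewrite exprMn -rmorphXn mul_mpolyC -scalerAr; congr (_ *: (_ * _)).
    by rewrite !mpolyXD -!expr2.
  rewrite (bigD1 i0) //= XE mcoeffZ [(m + _)%MM]addmC mcoeffMX big1 => [|i ne].
    by rewrite addr0 mulf_neq0 ?expf_neq0 // -mcoeff_msupp.
  rewrite XE mcoeffZ; apply/eqP; rewrite mulf_eq0; apply/orP; right.
  rewrite mcoeff_eq0 (perm_mem (msuppMX _ _)); apply/mapP => -[k /m_max k_m].
  move/mnmP/(_ i0); rewrite !mnmDE !mnm1E eqxx (negbTE ne) /= => Ek.
  by move: k_m; rewrite -[k i0]add0n -Ek leqNgt -[X in (X < _)%N]add0n ltn_add2r.
rewrite -E => /msupp_sum_le /flattenP [s /mapP [i _ ->]].
rewrite mul_mpolyC => /msuppZ_le /msupp_sqr [k k_P].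
move/mnmP/(_ i0); rewrite !mnmDE !mnm1E eqxx => Ek.
have k1 : (k i0 <= 1)%N by case: (h i) => _; apply.
have : (k i0 + k i0 <= 2)%N by apply: (leq_add k1 k1).
by rewrite -Ek addnA !addnS.
Qed.

(** Multiplication by the nonzero [fp] shifts degrees by 2, so every component of [q] outside degree
    [e - 2] vanishes. *)
Lemma diag_poly_quotient_homog q e : q * fp \is e.-homog -> q \is (e - 2).-homog.
Proof.
move=> hom.
have pih k : pihomog mdeg (k + 2) (q * fp) = pihomog mdeg k q * fp.
  rewrite {1}(pihomog_partitionE (mf:=mdeg) (leqnn (msize q))).
  rewrite mulr_suml raddf_sum /=.
  have homk j : pihomog mdeg j q * fp \is (j + 2).-homog.
    exact: dhomogM (pihomogP _ _ _) diag_poly_homog.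
  case: (ltnP k (msize q)) => [lt_k|le_k].
    rewrite (bigD1 (Ordinal lt_k)) //= (pihomog_dE (homk _)).
    rewrite big1 ?addr0 // => j ne.
    by rewrite (pihomog_ne0 _ (homk j)) // eqn_add2r.
  rewrite big1 => [|j _].
    rewrite [pihomog _ k q]pihomogE big_seq_cond big_pred0 ?mul0r // => m.
    apply/negbTE/nandP; case: (boolP (m \in msupp q)) => [m_q|]; last by left.
    by right; rewrite neq_ltn (leq_trans (msize_mdeg_lt m_q) le_k).
  rewrite (pihomog_ne0 _ (homk j)) // eqn_add2r neq_ltn.
  by rewrite (leq_trans (ltn_ord j)).
rewrite [q](pihomog_partitionE (mf:=mdeg) (leqnn _)); apply: rpred_sum => k _.
have [<-|ne] := eqVneq (nat_of_ord k) (e - 2)%N; first exact: pihomogP.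
suff -> : pihomog mdeg k q = 0 by exact: rpred0.
have ne_e : e != (k + 2)%N by apply: contraNneq ne => ->; rewrite addnK.
move/eqP: (pih k).
rewrite (pihomog_ne0 ne_e hom) eq_sym mulf_eq0 (negbTE diag_poly_neq0) orbF.
by move/eqP.
Qed.

End Polynomials.

(** * Lines through the generic point of the quadric *)

Section GenericPoint.
Variables (F : fieldType) (charF : 2%N \in [pchar F]) (d : nat).
Variables (a : 'I_d -> F) (i0 : 'I_d) (a0 : a i0 != 0).
Variables (L : fieldType) (iota : {rmorphism F -> L}) (x : 'I_d -> L).
Local Notation fp := (diag_poly a).
Local Notation ev := (mmap iota x).
Hypothesis ev_homog_eq0 : forall (e : nat) (p : {mpoly F[d]}), p \is e.-homog ->
  (ev p = 0 <-> exists q, p = q * fp).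
Hypothesis homog_ratio : forall z : L, exists (e : nat) (p q : {mpoly F[d]}),
  [/\ p \is e.-homog, q \is e.-homog, ev q != 0 & z = ev p / ev q].

Let charL : 2%N \in [pchar L].
Proof. exact: (rmorph_pchar iota). Qed.

Lemma ev_diag_poly : ev fp = 0.
Proof.
by apply/(ev_homog_eq0 (diag_poly_homog a)); exists 1; rewrite mul1r.
Qed.

(** Each numerator is multiplied by the other denominators. The single degree [e] matters because
    vanishing at [x] is characterised for homogeneous polynomials only. *)
Lemma common_denominator (I : finType) (z : I -> L) :
  exists e (P : I -> {mpoly F[d]}) Q,
    [/\ forall i, P i \is e.-homog, Q \is e.-homog, ev Q != 0
      & forall i, z i = ev (P i) / ev Q].
Proof.
have [e /fin_all_exists [p /fin_all_exists [q h]]] :=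
  fin_all_exists (fun i => homog_ratio (z i)).
have homog_prod (A : pred I) :
    \prod_(i | A i) q i \is (\sum_(i | A i) e i)%N.-homog.
  elim/big_rec2: _ => [|i k r _ IH]; first exact: dhomog1.
  by apply: dhomogM => //; case: (h i).
exists (\sum_i e i)%N, (fun i => p i * \prod_(j | j != i) q j), (\prod_i q i).
have nz (A : pred I) : ev (\prod_(i | A i) q i) != 0.
  by rewrite rmorph_prod; apply/prodf_neq0 => i _; case: (h i).
split=> // i.
  rewrite [(\sum_i e i)%N](bigD1 i) //=; apply: dhomogM; last exact: homog_prod.
  by case: (h i).
have [_ _ q0 ->] := h i.
by rewrite [\prod_i q i](bigD1 i) //= !rmorphM /= -mulf_div divff ?mulr1.
Qed.

(* The restriction of a polynomial to the line x + w 'X. *)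
Definition line_eval (w : 'I_d -> L) : {mpoly F[d]} -> {poly L} :=
  mmap (polyC \o iota) (fun i => (x i)%:P + w i *: 'X).

Lemma line_eval_coef0 w p : (line_eval w p)`_0 = ev p.
Proof.
rewrite -horner_coef0 /line_eval /mmap horner_sum; apply: eq_bigr => m _.
rewrite hornerM hornerC /mmap1 horner_prod; congr (_ * _).
by apply: eq_bigr => i _; rewrite horner_exp !hornerE.
Qed.

(** Additivity of squaring excludes a term linear in ['X], and the constant term is the value of
    [fp] at [x], which is zero. *)
Lemma line_eval_diag_poly w :
  line_eval w fp = (\sum_i iota (a i) * w i ^+ 2) *: 'X ^+ 2.
Proof.
have charLX : 2%N \in [pchar {poly L}] by rewrite pchar_lalg.
have E (i : 'I_d) : line_eval w ((a i)%:MP * 'X_i ^+ 2) =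
    (ev ((a i)%:MP * 'X_i ^+ 2))%:P + (iota (a i) * w i ^+ 2) *: 'X ^+ 2.
  have evE (S : comNzRingType) (f : {rmorphism F -> S}) y :
      mmap f y ((a i)%:MP * 'X_i ^+ 2) = f (a i) * y i ^+ 2.
    by rewrite rmorphM rmorphXn /= mmapC mmapX mmap1U.
  rewrite /line_eval !evE /=.
  rewrite (sqrrD2 charLX) mulrDr; congr (_ + _).
    by rewrite polyCM polyC_exp.
  by rewrite exprZn mul_polyC scalerA.
rewrite /fp /line_eval (raddf_sum (mmap _ _)) -/(line_eval w).
rewrite (eq_bigr _ (fun i _ => E i)) big_split /= -scaler_suml.
rewrite (_ : \sum_i (ev _)%:P = (ev fp)%:P); last first.
  by rewrite /fp (raddf_sum (mmap iota x)) /= (raddf_sum polyC).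
by rewrite ev_diag_poly polyC0 add0r.
Qed.

Lemma coef2_sqr (p : {poly L}) : (p ^+ 2)`_2 = p`_1 ^+ 2.
Proof.
rewrite expr2 coefM !big_ord_recl big_ord0 /= addr0 addrCA.
by rewrite [p`_2 * _]mulrC addrr_pchar2 // addr0 expr2.
Qed.

(** Coefficients of ['X ^+ 2] on the line are compared: [q] contributes its constant term, and each
    square on the left the square of a linear coefficient. *)
Lemma sqspan_ev_quotient (I : finType) (b : I -> F) (P : I -> {mpoly F[d]}) q w :
  \sum_i (b i)%:MP * P i ^+ 2 = q * fp ->
  sqspan (iota \o b) (ev q * \sum_i iota (a i) * w i ^+ 2).
Proof.
move=> E; exists (fun i => (line_eval w (P i))`_1).
have leM p1 p2 : line_eval w (p1 * p2) = line_eval w p1 * line_eval w p2.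
  exact: rmorphM.
have := congr1 (fun p => (line_eval w p)`_2) E.
rewrite /= leM line_eval_diag_poly.
rewrite -scalerAr coefZ coefMXn /= line_eval_coef0 mulrC => <-.
have -> : line_eval w (\sum_i (b i)%:MP * P i ^+ 2) =
          \sum_i line_eval w ((b i)%:MP * P i ^+ 2) by exact: raddf_sum.
rewrite coef_sum; apply: eq_bigr => i _.
rewrite leM expr2 leM -expr2 {1}/line_eval mmapC /=.
by rewrite mul_polyC coefZ coef2_sqr.
Qed.

(** [h j] is the value at [x] of the quotient by [fp] obtained after clearing denominators in the
    isotropic vector [w j]. The family [b] is separate from [a] because the result serves once with
    [a] itself and once with a basis of a field. *)
Lemma generic_stabilizer (I J : finType) (b : I -> F) (w : J -> I -> L) :
    sqindep b ->
    (forall j, \sum_i iota (b i) * w j i ^+ 2 = 0) ->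
    (forall t : J -> L,
       (forall i, \sum_j t j * w j i = 0) -> forall j, t j = 0) ->
  exists h : J -> L, sqindep h /\ forall j v,
    sqspan (iota \o b) (h j * \sum_i iota (a i) * v i ^+ 2).
Proof.
move=> b_ind w_ker w_ind.
have [e [P [Q [homP homQ Q0 wE]]]] :=
  common_denominator (fun ji : J * I => w ji.1 ji.2).
have {}wE j i : ev (P (j, i)) = w j i * ev Q by rewrite (wE (j, i)) divfK.
have hom_b j : \sum_i (b i)%:MP * P (j, i) ^+ 2 \is (e * 2).-homog.
  by apply: rpred_sum => i _; rewrite mul_mpolyC rpredZ ?dhomogMn.
have qP j : exists q, \sum_i (b i)%:MP * P (j, i) ^+ 2 = q * fp.
  apply/(ev_homog_eq0 (hom_b j)); rewrite (raddf_sum (mmap iota x)) /=.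
  have := congr1 ( *%R^~ (ev Q ^+ 2)) (w_ker j).
  rewrite /= mul0r => E0; rewrite -[RHS]E0 mulr_suml; apply: eq_bigr => i _.
  by rewrite rmorphM rmorphXn /= mmapC wE exprMn mulrA.
have {qP} [q qE] := fin_all_exists qP.
have hom_q j : q j \is (e * 2 - 2).-homog.
  by apply: (diag_poly_quotient_homog charF a0); rewrite -qE.
exists (fun j => ev (q j)); split=> [t Et|j v]; last first.
  exact: sqspan_ev_quotient (qE j).
have [e' [R [S [homR homS S0 tE]]]] := common_denominator t.
have {}tE j : ev (R j) = t j * ev S by rewrite tE divfK.
have hom_G : \sum_j q j * R j ^+ 2 \is (e * 2 - 2 + e' * 2).-homog.
  by apply: rpred_sum => j _; apply: dhomogM => //; apply: dhomogMn.
have [g gE] : exists g, \sum_j q j * R j ^+ 2 = g * fp.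
  apply/(ev_homog_eq0 hom_G); rewrite (raddf_sum (mmap iota x)) /=.
  have := congr1 ( *%R^~ (ev S ^+ 2)) Et.
  rewrite /= mul0r => E0; rewrite -[RHS]E0 mulr_suml; apply: eq_bigr => j _.
  by rewrite rmorphM rmorphXn /= tE exprMn mulrA.
(* A relation between the [h j] makes [fp] divide the sum of the [q j * R j ^+ 2], hence [fp ^+ 2]
   divide the present sum. Then [fp] divides each inner sum, and evaluation at [x] gives a linear
   relation between the [w j]. *)
have dvd : \sum_i (b i)%:MP * (\sum_j R j * P (j, i)) ^+ 2 = g * fp ^+ 2.
  rewrite expr2 mulrA -gE mulr_suml.
  under eq_bigr => i _ do rewrite (sqrr_sum2 (pchar_mpoly2 charF d)) mulr_sumr.
  rewrite exchange_big /=; apply: eq_bigr => j _.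
  rewrite mulrAC -qE mulr_suml; apply: eq_bigr => i _.
  by rewrite exprMn mulrCA mulrC.
apply: w_ind => i.
have [r rE] := sqr_diag_poly_dvd charF a0 b_ind dvd i.
have := congr1 ev rE.
rewrite rmorphM /= ev_diag_poly mulr0 (raddf_sum (mmap _ _)) /= => E0.
apply: (mulIf S0); apply: (mulIf Q0); rewrite !mul0r -[RHS]E0 !mulr_suml.
apply: eq_bigr => j _.
by rewrite rmorphM /= tE wE -mulrA mulrACA.
Qed.

End GenericPoint.

(** * Dimension counts over K^2 *)

Section SquareSpans.
Variables (K : fieldType) (charK : 2%N \in [pchar K]).

Section Family.
Variables (I : finType) (c : I -> K).

Lemma sqspan0 : sqspan c 0.
Proof.
by exists (fun=> 0); rewrite big1 // => i _; rewrite expr0n mulr0.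
Qed.

Lemma sqspanD y z : sqspan c y -> sqspan c z -> sqspan c (y + z).
Proof.
move=> [t ->] [u ->]; exists (fun i => t i + u i).
by rewrite -big_split; apply: eq_bigr => i _ /=; rewrite (sqrrD2 charK) mulrDr.
Qed.

Lemma sqspanZ a y : sqspan c y -> sqspan c (y * a ^+ 2).
Proof.
move=> [t ->]; exists (fun i => t i * a).
by rewrite mulr_suml; apply: eq_bigr => i _; rewrite exprMn -mulrA.
Qed.

Lemma sqspan_gen i : sqspan c (c i).
Proof.
by exists (fun j => (j == i)%:R); rewrite sum_delta_sqr.
Qed.

Lemma sqspan_sum (J : finType) (f : J -> K) :
  (forall j, sqspan c (f j)) -> sqspan c (\sum_j f j).
Proof.
by move=> h; elim/big_rec: _ => [|j y _ IH]; [exact: sqspan0|exact: sqspanD].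
Qed.

Lemma sqspan_trans (J : finType) (e : J -> K) y :
  (forall j, sqspan c (e j)) -> sqspan e y -> sqspan c y.
Proof. by move=> h [t ->]; apply: sqspan_sum => j; apply: sqspanZ. Qed.

End Family.

(** If J were larger than I, the matrix of square roots of the coordinates would have a nonzero left
    kernel vector; squaring this K-linear relation gives a relation over K^2 between the [e j]. *)
Lemma sqindep_card (I J : finType) (c : I -> K) (e : J -> K) :
  sqindep e -> (forall j, sqspan c (e j)) -> (#|J| <= #|I|)%N.
Proof.
move=> e_ind /fin_all_exists [A eE]; rewrite leqNgt; apply/negP => lt_IJ.
pose M := \matrix_(j < #|J|, i < #|I|) A (enum_val j) (enum_val i).
have : kermx M != 0.
  rewrite kermx_eq0 /row_free neq_ltn.
  by rewrite (leq_ltn_trans (rank_leq_col M)).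
case/rowV0Pn => u /sub_kermxP uM /negP; apply; apply/eqP/rowP => j.
rewrite mxE -[j]enum_valK.
apply: (e_ind (fun j => u 0 (enum_rank j))).
under eq_bigr => k _ do rewrite eE mulr_suml.
rewrite exchange_big big1 //= => i _.
under eq_bigr => k _ do rewrite -mulrA -exprMn.
rewrite -mulr_sumr -(sqrr_sum2 charK) [X in X ^+ 2](_ : _ = 0) ?expr0n ?mulr0 //.
have := congr1 (fun v : 'rV_ _ => v 0 (enum_rank i)) uM; rewrite !mxE => E.
rewrite -[RHS]E (reindex (@enum_val J xpredT)) /=; last first.
  by apply: onW_bij; apply: enum_val_bij.
by apply: eq_bigr => k _; rewrite mxE enum_valK enum_rankK mulrC.
Qed.

(** Exchange argument: a [y] outside the span of [e] would extend [e] to an independent family too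
    large for the span of [c]. *)
Lemma sqindep_span (I J : finType) (c : I -> K) (e : J -> K) y :
  sqindep e -> (forall j, sqspan c (e j)) -> (#|I| <= #|J|)%N ->
  sqspan c y -> sqspan e y.
Proof.
move=> e_ind e_c le_IJ y_c; apply: NNPP => y_e.
pose e' (k : 'I_1 + J) := if k is inr j then e j else y.
have e'_ind : sqindep e'.
  move=> t; rewrite big_sumType big_ord1 /= => E.
  have ty : t (inl ord0) = 0.
    apply/eqP; apply: contraT => t0; case: y_e.
    have -> : y = (\sum_j e j * t (inr j) ^+ 2) * (t (inl ord0))^-1 ^+ 2.
      apply: (mulIf (expf_neq0 2 t0)).
      rewrite -mulrA -exprMn mulVf // expr1n mulr1.
      by apply/eqP; rewrite -subr_eq0 oppr_pchar2 ?E.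
    by apply: sqspanZ; exists (fun j => t (inr j)).
  move: E; rewrite ty expr0n mulr0 add0r => /e_ind E [k|j].
    by rewrite (ord1 k).
  exact: E.
have e'_c k : sqspan c (e' k) by case: k.
have := sqindep_card e'_ind e'_c.
by rewrite card_sum card_ord ltnNge le_IJ.
Qed.


Definition nth_fam (c : seq K) (i : 'I_(size c)) : K := c`_i.

(** Coefficients indexed by [nat] let lists be concatenated by shifting indices, without casts
    between ordinals. *)
Lemma sqspan_nth c y : sqspan (@nth_fam c) y <->
  exists t : nat -> K, y = \sum_(i < size c) c`_i * t i ^+ 2.
Proof.
split=> [[t ->]|[t ->]]; last by exists (fun i : 'I_(size c) => t i).
exists (fun k => oapp t 0 (insub k)); apply: eq_bigr => i _.
by rewrite valK.
Qed.

Lemma sqindep_nth c : sqindep (@nth_fam c) <->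
  forall t : nat -> K, \sum_(i < size c) c`_i * t i ^+ 2 = 0 ->
    forall i, (i < size c)%N -> t i = 0.
Proof.
split=> [c_ind t E i lt_i|c_ind t E i].
  exact: (c_ind (fun i : 'I_(size c) => t i) E (Ordinal lt_i)).
have := c_ind (fun k => oapp t 0 (insub k)) _ i (ltn_ord i).
rewrite valK; apply; rewrite -[RHS]E; apply: eq_bigr => j _.
by rewrite valK.
Qed.

Lemma sum_nth_cat (c c' : seq K) (t : nat -> K) :
  \sum_(i < size (c ++ c')) (c ++ c')`_i * t i ^+ 2 =
  \sum_(i < size c) c`_i * t i ^+ 2 +
  \sum_(i < size c') c'`_i * t (size c + i)%N ^+ 2.
Proof.
rewrite size_cat big_split_ord; congr (_ + _); apply: eq_bigr => i _ /=.
  by rewrite nth_cat ltn_ord.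
by rewrite nth_cat ltnNge leq_addr addKn.
Qed.

Lemma sum_nth_scale a (c : seq K) (t : nat -> K) :
  \sum_(i < size (map ( *%R a) c)) (map ( *%R a) c)`_i * t i ^+ 2 =
  a * \sum_(i < size c) c`_i * t i ^+ 2.
Proof.
rewrite size_map mulr_sumr; apply: eq_bigr => i _.
by rewrite (nth_map 0) // mulrA.
Qed.

(** * Fields K^2(s) generated over the squares *)

Lemma pfister_coefs_cons (a : K) s :
  pfister_coefs (a :: s) = pfister_coefs s ++ map ( *%R a) (pfister_coefs s).
Proof.
rewrite /= /diag_tensor /= cats0; congr (_ ++ _).
by rewrite (eq_map (@mul1r K)) map_id.
Qed.

Lemma size_pfister_coefs (s : seq K) : size (pfister_coefs s) = (2 ^ size s)%N.
Proof.
elim: s => // a s IH.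
by rewrite pfister_coefs_cons size_cat size_map IH expnS mul2n addnn.
Qed.

(* pf_span s is the subfield K^2(s); pf_indep s says that s is 2-independent. *)
Definition pf_span s := sqspan (@nth_fam (pfister_coefs s)).
Definition pf_indep s := sqindep (@nth_fam (pfister_coefs s)).

Lemma pf_spanD s y z : pf_span s y -> pf_span s z -> pf_span s (y + z).
Proof. exact: sqspanD. Qed.

Lemma pf_spanZ s a y : pf_span s y -> pf_span s (y * a ^+ 2).
Proof. exact: sqspanZ. Qed.

Lemma pf_span_nil y : pf_span [::] y <-> exists t, y = t ^+ 2.
Proof.
rewrite /pf_span; split=> [[t ->]|[t ->]].
  by exists (t ord0); rewrite big_ord1 /nth_fam /= mul1r.
by exists (fun=> t); rewrite big_ord1 /nth_fam /= mul1r.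
Qed.

Lemma pf_span_cons a s y : pf_span (a :: s) y <->
  exists p q, [/\ pf_span s p, pf_span s q & y = p + a * q].
Proof.
rewrite /pf_span pfister_coefs_cons; split=> [/sqspan_nth [t ->]|].
  rewrite sum_nth_cat (sum_nth_scale a _ (fun i => _ (_ + i)%N)).
  set n := size (pfister_coefs s); set p := \sum_(i < n) _; set q := \sum_(i < n) _.
  exists p, q; split=> //; apply/sqspan_nth; first by exists t.
  by exists (fun i => t (n + i)%N).
case=> p [q [/sqspan_nth [t ->] /sqspan_nth [u ->] ->]]; apply/sqspan_nth.
pose n := size (pfister_coefs s).
pose w i := if (i < n)%N then t i else u (i - n)%N; exists w.
rewrite sum_nth_cat (sum_nth_scale a _ (fun i => _ (_ + i)%N)).
congr (_ + _ * _); apply: eq_bigr => i _.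
  by rewrite /w ltn_ord.
by rewrite /w ltnNge leq_addr addKn.
Qed.

Lemma pf_indep_nil : pf_indep [::].
Proof.
move=> t; rewrite big_ord1 /nth_fam /= mul1r => /eqP.
by rewrite expf_eq0 => /eqP t0 i; rewrite (ord1 i).
Qed.

Lemma pf_span_subset a s y : pf_span s y -> pf_span (a :: s) y.
Proof.
move=> y_s; apply/pf_span_cons; exists y, 0; rewrite mulr0 addr0; split=> //.
exact: sqspan0.
Qed.

Lemma pf_span_sqr s a : pf_span s (a ^+ 2).
Proof.
elim: s => [|b s IH]; first by apply/pf_span_nil; exists a.
exact: pf_span_subset.
Qed.

Lemma pf_span_mem s a : a \in s -> pf_span s a.
Proof.
elim: s => // b s IH; rewrite inE => /predU1P [->|/IH].
  2: exact: pf_span_subset.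
apply/pf_span_cons; exists 0, 1; rewrite add0r mulr1; split=> //.
  exact: sqspan0.
by rewrite -(expr1n _ 2); apply: pf_span_sqr.
Qed.

Lemma pf_spanM s y z : pf_span s y -> pf_span s z -> pf_span s (y * z).
Proof.
elim: s y z => [|a s IH] y z.
  move=> /pf_span_nil [t ->] /pf_span_nil [u ->]; apply/pf_span_nil.
  by exists (t * u); rewrite exprMn.
move=> /pf_span_cons [p [q [hp hq ->]]] /pf_span_cons [p' [q' [hp' hq' ->]]].
(* The term in [a ^+ 2] goes to the first part, since [a ^+ 2] is a scalar from K^2. *)
apply/pf_span_cons; exists (p * p' + q * q' * a ^+ 2), (p * q' + q * p').
split; first by apply: pf_spanD; last apply: pf_spanZ; apply: IH.
  by apply: pf_spanD; apply: IH.
by ring.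
Qed.

(** Induction over K^2(s) for a set [A] not yet known to be closed under products: only
    multiplication by the generators is asked. *)
Lemma pf_span_ind (A : K -> Prop) s :
    (forall y z, A y -> A z -> A (y + z)) -> (forall t, A (t ^+ 2)) ->
    (forall a y, a \in s -> A y -> A (a * y)) ->
  forall y, pf_span s y -> A y.
Proof.
move=> AD Asqr; elim: s => [|a s IH] AM y; first by case/pf_span_nil => t ->.
case/pf_span_cons => p [q [hp hq ->]].
have AM' b z : b \in s -> A z -> A (b * z).
  by move=> b_s; apply: AM; rewrite inE b_s orbT.
by apply: AD; [exact: IH|apply: AM; rewrite ?mem_head //; exact: IH].
Qed.

Lemma pf_indep_cons a s : pf_indep s -> ~ pf_span s a -> pf_indep (a :: s).
Proof.
move=> /sqindep_nth s_ind a_s; rewrite /pf_indep pfister_coefs_cons.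
apply/sqindep_nth => t.
rewrite sum_nth_cat (sum_nth_scale a _ (fun i => _ (_ + i)%N)) size_cat size_map.
set n := size (pfister_coefs s); set p := \sum_(i < n) _; set q := \sum_(i < n) _.
have p_s : pf_span s p by apply/sqspan_nth; exists t.
have q_s : pf_span s q by apply/sqspan_nth; exists (fun i => t (n + i)%N).
move=> E.
have q0 : q = 0.
  apply/eqP; apply: contraT => q0; case: a_s.
  (* The quotient p / q is written as a product times a square, which reduces it to [pf_spanM] and
     [pf_spanZ]. *)
  have -> : a = p * q * q^-1 ^+ 2.
    apply: (mulIf q0); rewrite expr2 mulrA mulfK // divfK //.
    by apply/eqP; rewrite -subr_eq0 oppr_pchar2 // addrC E.
  by apply: pf_spanZ; apply: pf_spanM.
have p0 : p = 0 by rewrite q0 mulr0 addr0 in E.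
move=> i lt_i; case: (ltnP i n) => [lt_in|le_ni]; first exact: (s_ind _ p0).
rewrite -(subnKC le_ni); apply: (s_ind (fun i => t (n + i)%N) q0).
by rewrite ltn_subLR.
Qed.

(** Elements of [l] are adjoined one at a time, and only when outside the field built so far. *)
Lemma pf_basis (l : seq K) : exists s,
  [/\ {subset s <= l}, pf_indep s & forall y, y \in l -> pf_span s y].
Proof.
elim: l => [|a l [s [s_l s_ind l_s]]].
  by exists [::]; split=> //; exact: pf_indep_nil.
case: (classic (pf_span s a)) => [a_s|a_s].
  exists s; split=> // [b /s_l b_l|b]; first by rewrite inE b_l orbT.
  by rewrite inE => /predU1P [->|/l_s].
exists (a :: s); split; last 2 first.
- exact: pf_indep_cons.
- move=> b; rewrite inE => /predU1P [->|/l_s].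
    by apply: pf_span_mem; rewrite mem_head.
  exact: pf_span_subset.
by move=> b; rewrite !inE => /predU1P [->|/s_l ->]; rewrite ?eqxx ?orbT.
Qed.

(* The stabilizer of A contains a field of degree at least 2^(n-1) over the
   squares, so A either equals that field or a quadratic extension of it. *)
Lemma stable_span_mul n m (A : K -> Prop) (e : 'I_(2 ^ n) -> K)
    (h : 'I_m -> K) :
    (1 < n)%N -> (2 ^ (n - 2) < m)%N ->
    (forall y z, A y -> A z -> A (y + z)) ->
    (forall y t, A y -> A (y * t ^+ 2)) -> A 1 ->
    (forall y, A y -> sqspan e y) ->
    sqindep h -> (forall j y, A y -> A (h j * y)) ->
  forall y z, A y -> A z -> A (y * z).
Proof.
move=> n2 m_gt AD AZ A1 A_e h_ind h_A.
have [t [t_h t_ind h_t]] := pf_basis (codom h).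
pose H y := forall z, A z -> A (y * z).
have t_H y : pf_span t y -> H y.
  apply: (pf_span_ind (A := H)) => 
    [y1 y2 H1 H2 z Az|u z Az|b y1 /t_h b_h H1 z Az].
  - by rewrite mulrDl; apply: AD; [apply: H1|apply: H2].
  - by rewrite mulrC; apply: AZ.
  - by have /codomP [j ->] := b_h; rewrite -mulrA; apply: h_A; apply: H1.
have t_A y : pf_span t y -> A y by move/t_H/(_ 1 A1); rewrite mulr1.
(* The independent [h j] lie in K^2(t), so [m <= 2 ^ size t]; with [2 ^ (n - 2) < m] this gives
   [n - 2 < size t]. *)
have t_ge : (n <= (size t).+1)%N.
  have h_span j : sqspan (@nth_fam (pfister_coefs t)) (h j).
    by apply: h_t; apply: codom_f.
  have := sqindep_card h_ind h_span.
  rewrite !card_ord size_pfister_coefs => /(leq_trans m_gt).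
  by rewrite ltn_exp2l // ltn_subLR // addn2 !ltnS.
case: (classic (forall y, A y -> pf_span t y)) => [A_t|].
  by move=> y z /A_t /t_H; apply.
move=> A_t; have [f] := not_all_ex_not _ _ A_t.
case/(imply_to_and (A f)) => Af f_t.
have ft_ind := pf_indep_cons t_ind f_t.
have ft_A y : pf_span (f :: t) y -> A y.
  case/pf_span_cons => p [q [p_t q_t ->]].
  by apply: AD; [apply: t_A|rewrite mulrC; apply: (t_H q)].
(* K^2(t, f) lies in [A] and has degree at least [2 ^ n], while [A] lies in a span of [2 ^ n]
   elements, so the two coincide. *)
have A_ft y : A y -> pf_span (f :: t) y.
  move/A_e; apply: (sqindep_span ft_ind).
    by move=> j; apply: A_e; apply: ft_A; apply: sqspan_gen.
  by rewrite !card_ord size_pfister_coefs leq_exp2l.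
by move=> y z /A_ft y_ft /A_ft z_ft; apply: ft_A; apply: pf_spanM.
Qed.

End SquareSpans.

(** The [w j] form a basis of the left kernel of the N by k matrix of square roots of the
    coordinates; its dimension is at least N - k. *)
Lemma sqspan_relations (K : fieldType) (charK : 2%N \in [pchar K])
    k (e : 'I_k -> K) N (c : 'I_N -> K) :
    (forall i, sqspan e (c i)) ->
  exists r (w : 'I_r -> 'I_N -> K),
    [/\ (N <= r + k)%N, forall j, \sum_i c i * w j i ^+ 2 = 0
      & forall t : 'I_r -> K,
          (forall i, \sum_j t j * w j i = 0) -> forall j, t j = 0].
Proof.
move=> /fin_all_exists [B cE]; pose M := \matrix_(i < N, j < k) B i j.
pose R := row_base (kermx M).
exists (\rank (kermx M)), (fun j i => R j i); split.
- by rewrite mxrank_ker addnC -leq_subLR leq_sub2l // rank_leq_col.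
- move=> j; under eq_bigr => i _ do rewrite cE mulr_suml.
  rewrite exchange_big big1 //= => l _.
  under eq_bigr => i _ do rewrite -mulrA -exprMn.
  rewrite -mulr_sumr -(sqrr_sum2 charK) [X in X ^+ 2](_ : _ = 0) ?expr0n ?mulr0 //.
  have RM : R *m M = 0 by apply/sub_kermxP; rewrite eq_row_base.
  have := congr1 (fun v : 'M_(_, _) => v j l) RM; rewrite !mxE => RMjl.
  by rewrite -[RHS]RMjl; apply: eq_bigr => i _; rewrite !mxE mulrC.
- move=> t E j; have : (\row_j t j) *m R = 0.
    by apply/rowP => i; rewrite !mxE -[RHS](E i); apply: eq_bigr => l _; rewrite mxE.
  move/eqP; rewrite mulmx_free_eq0 ?row_base_free // => /eqP/rowP/(_ j).
  by rewrite !mxE.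
Qed.

(** * Anisotropic quasilinear forms in coordinates *)

Section AnisotropicForm.
Variables (F : fieldType) (V : vectType F) (phi : V -> F).
Hypotheses (phi_ql : quasilinear_form phi) (phi_an : anisotropic phi).

Lemma form_sum (I : finType) (t : I -> F) (v : I -> V) :
  phi (\sum_i t i *: v i) = \sum_i phi (v i) * t i ^+ 2.
Proof.
have [phiZ phiD] := phi_ql.
have phi0 : phi 0 = 0 by rewrite -(scale0r 0) phiZ expr0n mul0r.
rewrite (big_morph phi phiD phi0); apply: eq_bigr => i _.
by rewrite phiZ mulrC.
Qed.

Lemma form_coordE v :
  phi v = \sum_i form_coef phi i * coord (vbasis {:V}) i v ^+ 2.
Proof.
rewrite {1}(coord_vbasis (memvf v)) form_sum.
by apply: eq_bigr => i _; rewrite /form_coef (tnth_nth 0).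
Qed.

Lemma form_coef_indep : sqindep (form_coef phi).
Proof.
move=> t E; have /freeP := basis_free (vbasisP {:V}); apply.
apply/eqP; apply: contraT => nz; case: phi_an; eexists; split; first exact: nz.
rewrite form_sum -[RHS]E; apply: eq_bigr => i _.
by rewrite /form_coef (tnth_nth 0).
Qed.

(** The square roots of the coordinates of the [form_coef phi i / c] are the matrix of a linear map.
    By additivity of squaring it carries phi / c to the quasi-Pfister form, and anisotropy makes it
    injective. *)
Lemma scaled_subform_pfister (charF : 2%N \in [pchar F]) (c : F) (s : seq F) :
    c != 0 -> (forall i, pf_span s (form_coef phi i / c)) ->
  exists (W : vectType F) (sigma : W -> F),
    similar phi sigma /\ subform sigma (@quasi_pfister F s).
Proof.
move=> c0 /fin_all_exists [T TE].
exists V, (fun v => phi v / c); split.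
  exists c; split=> //; exists \1%VF; split=> [||v].
  - by apply/eqP/lker0P => v w; rewrite !id_lfunE.
  - exact: lim1g.
  - by rewrite id_lfunE mulrC divfK.
pose b := coord (vbasis {:V}).
pose g v : 'rV_(size (pfister_coefs s)) := \row_k \sum_i b i v * T i k.
have g_lin : linear g.
  move=> a v w; apply/rowP => k; rewrite !mxE mulr_sumr -big_split.
  by apply: eq_bigr => i _ /=; rewrite /b linearP /= mulrDl mulrA.
pose gL : {linear V -> 'rV_(size (pfister_coefs s))} :=
  HB.pack g (GRing.isLinear.Build F V _ _ g g_lin).
have gE v : quasi_pfister (linfun gL v) = phi v / c.
  rewrite lfunE /quasi_pfister /diag_form form_coordE mulr_suml.
  under eq_bigr => k _ do rewrite mxE (sqrr_sum2 charF) mulr_sumr.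
  rewrite exchange_big /=; apply: eq_bigr => i _.
  rewrite mulrAC TE mulr_suml; apply: eq_bigr => k _.
  by rewrite exprMn mulrCA mulrC.
exists (linfun gL); split=> //; apply/eqP; rewrite -subv0; apply/subvP => v.
rewrite memv_ker memv0 => /eqP gv; apply: contraT => v0; case: phi_an.
exists v; split=> //; apply: (mulIf (invr_neq0 c0)).
rewrite mul0r -gE gv /quasi_pfister /diag_form big1 // => k _.
by rewrite mxE expr0n mulr0.
Qed.

End AnisotropicForm.

(** * Values of the form over an extension field *)

Section ScalarExtension.
Variables (F : fieldType) (charF : 2%N \in [pchar F]).
Variables (V : vectType F) (phi : V -> F).
Variables (L : fieldType) (iota : {rmorphism F -> L}).

Let charL : 2%N \in [pchar L].
Proof. exact: (rmorph_pchar iota). Qed.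

Lemma scalar_extD v w :
  scalar_ext phi iota (v + w) = scalar_ext phi iota v + scalar_ext phi iota w.
Proof.
rewrite /scalar_ext -big_split; apply: eq_bigr => i _ /=.
by rewrite mxE (sqrrD2 charL) mulrDr.
Qed.

Lemma scalar_extZ c v :
  scalar_ext phi iota (c *: v) = scalar_ext phi iota v * c ^+ 2.
Proof.
rewrite /scalar_ext mulr_suml; apply: eq_bigr => i _.
by rewrite mxE exprMn mulrCA mulrC.
Qed.

(** The form vanishes on the isotropic subspace, so all its values are taken on a complement, a
    basis of which provides [e]. *)
Lemma scalar_ext_span k : isotropy_index (scalar_ext phi iota) k ->
  exists e : 'I_(\dim {:V} - k) -> L,
    forall v, sqspan e (scalar_ext phi iota v).
Proof.
case=> U [UE <-].
have <- : \dim U^C = (\dim {:V} - \dim U)%N.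
  by rewrite dimv_compl dimvf /dim /= mul1n.
exists (fun j => scalar_ext phi iota (tnth (vbasis U^C%VS) j)) => v.
have /memv_addP [u u_U [w w_C ->]] : v \in (U + U^C)%VS.
  by rewrite addv_complf memvf.
rewrite scalar_extD (iffLR (UE u) u_U) add0r (coord_vbasis w_C).
exists (fun j => coord (vbasis U^C%VS) j w).
have ext0 : scalar_ext phi iota 0 = 0.
  by rewrite -(scale0r 0) scalar_extZ expr0n mulr0.
rewrite (big_morph _ scalar_extD ext0); apply: eq_bigr => j _.
by rewrite scalar_extZ (tnth_nth 0).
Qed.

End ScalarExtension.

(** * Degree of the norm field F^2(a_i / a_i0) under maximal splitting, and the theorem *)

Lemma maximal_splitting_norm_degree (F : fieldType) (charF : 2%N \in [pchar F])
    (V : vectType F) (phi : V -> F) (phi_ql : quasilinear_form phi)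
    (phi_an : anisotropic phi) n m (i0 : 'I_(\dim {:V})) :
    (1 < n)%N -> \dim {:V} = (2 ^ n + m)%N -> (2 ^ (n - 2) < m)%N ->
    first_isotropy_index phi m ->
  exists s, (forall i, pf_span s (form_coef phi i / form_coef phi i0)) /\
    (2 ^ size s <= 2 ^ n.+1)%N.
Proof.
move=> n2 dimV m_gt [L [iota [[x [ev0 ratio]] idx]]].
have charL : 2%N \in [pchar L] by exact: (rmorph_pchar iota).
pose a := form_coef phi; pose phiL := scalar_ext phi iota.
have a_ind : sqindep a := form_coef_indep phi_ql phi_an.
have a_neq0 : a i0 != 0 := sqindep_neq0 i0 a_ind.
pose a0 := iota (a i0); have a0_neq0 : a0 != 0 by rewrite fmorph_eq0.
have stab := generic_stabilizer charF a_neq0 ev0 ratio.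
have [e0 e0_span] := scalar_ext_span charF idx.
have e_size : (\dim {:V} - m = 2 ^ n)%N by rewrite dimV addnK.
rewrite e_size in e0 e0_span.
pose e j := e0 j / a0.
(* Values of [phiL] divided by [a0], so that 1 belongs to [E]. *)
pose E y := exists v, y * a0 = phiL v.
have e_E y : E y -> sqspan e y.
  case=> v vE; have [t tE] := e0_span v; exists t.
  apply: (mulIf a0_neq0); rewrite vE /phiL tE mulr_suml.
  by apply: eq_bigr => j _; rewrite /e mulrAC divfK.
have ED y z : E y -> E z -> E (y + z).
  by move=> [v vE] [w wE]; exists (v + w); rewrite mulrDl vE wE -scalar_extD.
have EZ y t : E y -> E (y * t ^+ 2).
  by move=> [v vE]; exists (t *: v); rewrite mulrAC vE /phiL scalar_extZ.
have Ea i : E (iota (a i / a i0)).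
  exists (delta_mx 0 i); rewrite -rmorphM divfK // /phiL /scalar_ext.
  rewrite -[LHS](sum_delta_sqr (iota \o a)); apply: eq_bigr => j _.
  by rewrite mxE.
have E1 : E 1 by have := Ea i0; rewrite divff // rmorph1.
(* First use of [stab], with [b := a]: a basis of the isotropic subspace gives independent elements
   multiplying [E] into itself. *)
have EM : forall y z, E y -> E z -> E (y * z).
  case: idx => U [UE dimU]; rewrite -dimU in m_gt.
  pose w j i := tnth (vbasis U) j 0 i.
  have [|t wt|h [h_ind h_span]] := stab _ _ a w a_ind.
  - move=> j; apply/UE; apply: vbasis_mem; exact: mem_tnth.
  - have /freeP := basis_free (vbasisP U); apply.
    apply/rowP => i; rewrite summxE mxE -[RHS](wt i); apply: eq_bigr => j _.
    by rewrite mxE /w (tnth_nth 0).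
  apply: (stable_span_mul charL n2 m_gt ED EZ E1 e_E h_ind) => j y [v vE].
  have [t tE] := h_span j (fun i => v 0 i).
  exists (\row_i t i); rewrite -mulrA vE /phiL tE.
  by apply: eq_bigr => i _; rewrite mxE.
have [s [s_a s_ind a_s]] := pf_basis charF (codom (fun i => a i / a i0)).
exists s; split=> [i|]; first exact/a_s/(codom_f (fun i => a i / a i0)).
pose b := @nth_fam F (pfister_coefs s).
have Eb y : pf_span s y -> E (iota y).
  apply: (pf_span_ind (A := fun y => E (iota y))) => [y1 y2 h1 h2|t|c z /s_a].
  - by rewrite rmorphD; apply: ED.
  - by rewrite rmorphXn -[_ ^+ 2]mul1r; apply: EZ.
  - by case/codomP => i -> Ez; rewrite rmorphM; apply: EM.
have b_span i : sqspan e (iota (b i)) by apply: e_E; apply: Eb; apply: sqspan_gen.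
(* The N members of [b] lie over L in a span of [2 ^ n] elements, which leaves at least N - 2^n
   independent isotropic vectors. *)
have [r [w [N_le w_ker w_ind]]] := sqspan_relations charL b_span.
have [h [h_ind h_span]] := stab _ _ b w s_ind w_ker w_ind.
(* At the unit vector of index [i0] the form takes the value [a0]. The independent [h j * a0] thus
   lie in the span of [e], whence [r <= 2 ^ n] and N is at most 2^(n+1). *)
have h_e j : sqspan e (h j * a0).
  apply: (sqspan_trans charL b_span).
  have := h_span j (fun i => (i == i0)%:R).
  by rewrite (sum_delta_sqr (iota \o a)).
have ha_ind : sqindep (fun j => h j * a0).
  move=> t E0; apply: h_ind; apply: (mulIf a0_neq0); rewrite mul0r -[RHS]E0.
  by rewrite mulr_suml; apply: eq_bigr => j _; rewrite mulrAC.
have := sqindep_card charL ha_ind h_e; rewrite !card_ord => r_le.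
rewrite -size_pfister_coefs (leq_trans N_le) //.
by rewrite expnS mul2n -addnn leq_add2r.
Qed.

Theorem theorem9p6 (F : fieldType) (charF : 2%N \in [pchar F])
    (V : vectType F) (phi : V -> F)
    (phi_ql : quasilinear_form phi) (phi_an : anisotropic phi)
    (n : nat) (n_ge2 : (2 <= n)%N)
    (dim_phi : (2 ^ n + 2 ^ (n - 2) < \dim {:V} <= 2 ^ (n + 1))%N)
    (phi_ms : maximal_splitting phi) :
  quasi_pfister_neighbour phi.
Proof.
have [dim_gt dim_le] := andP dim_phi.
have [_ [n' [m [dimE /andP [m1 m_le] idx]]]] := phi_ms.
have dim_gt' : (2 ^ n < \dim {:V})%N.
  by rewrite (leq_ltn_trans _ dim_gt) ?leq_addr.
(* The dimension exceeds both [2 ^ n] and [2 ^ n'], and is at most twice either of them. *)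
have nn' : n' = n.
  apply/eqP; rewrite eqn_leq; apply/andP.
  split; rewrite -ltnS -(ltn_exp2l _ _ (ltnSn 1)).
    by rewrite -(addn1 n) (leq_trans _ dim_le) // dimE -addn1 leq_add2l.
  by rewrite (leq_trans dim_gt') // dimE expnS mul2n -addnn leq_add2l.
rewrite {}nn' in dimE m_le.
have m_gt : (2 ^ (n - 2) < m)%N by rewrite dimE ltn_add2l in dim_gt.
have dim1 : (1 < \dim {:V})%N by rewrite (leq_ltn_trans _ dim_gt') // expn_gt0.
pose i0 := Ordinal (ltnW dim1).
have a_ind := form_coef_indep phi_ql phi_an.
have [s [a_s s_le]] :=
  maximal_splitting_norm_degree charF phi_ql phi_an i0 n_ge2 dimE m_gt idx.
have [W [sigma [sim sub]]] := 
  scaled_subform_pfister phi_ql phi_an charF (sqindep_neq0 i0 a_ind) a_s.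
split=> //; exists s, W, sigma; split=> //.
by rewrite size_pfister_coefs (leq_ltn_trans s_le) // expnS ltn_pmul2l.
Qed.
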